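(* Let $m'$ be an odd positive integer not divisible by $3$. Then there is no generalized bent function $f:\mathbb{Z}_3\to\mathbb{Z}_{2m'}$.
   Context: A function $f:G\to\mathbb{Z}_m$ on a finite abelian group $G$ is a generalized bent function if $\left|\sum_{x\in G}\zeta_m^{f(x)}\chi(x)\right|^2=|G|$ for every character $\chi$ of $G$, where $\zeta_m$ is a primitive $m$-th root of unity. *)

(* Defs.v *)
From HB Require Import structures.
From mathcomp Require Import all_boot all_order all_algebra all_fingroup.
From mathcomp Require Import all_solvable all_field all_character.

Set Implicit Arguments.
Unset Strict Implicit.
Unset Printing Implicit Defensive.

Import Order.TTheory GRing.Theory Num.Theory.
Local Open Scope ring_scope.

(* The finite abelian group is the additive group of [G]; its characters are
   the linear characters of the full group [set: G].  The factor [zeta ^+ f x]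
   uses the representative of [f x] below [m], so it is the usual
   zeta ^ (f x) when [zeta ^+ m = 1]. *)
Definition generalized_bent (G : finZmodType) (m : nat) (zeta : algC)
    (f : G -> 'Z_m) : Prop :=
  forall chi : 'CF([set: G]), chi \is a linear_char ->
    `|\sum_(x : G) zeta ^+ (f x) * chi x| ^+ 2 = #|G|%:R.

(* Main.v *)
Require Import Defs.
From HB Require Import structures.
From mathcomp Require Import all_boot all_order all_algebra all_fingroup.
From mathcomp Require Import all_solvable all_field all_character.
From mathcomp Require Import ring.

Set Implicit Arguments.
Unset Strict Implicit.
Unset Printing Implicit Defensive.

Import Order.TTheory GRing.Theory Num.Theory FinRing.Theory.
Local Open Scope ring_scope.

(** By second orthogonality, a generalized bent function has vanishing
    autocorrelation at every nonzero shift.  On Z_3, with a, b, c the values of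
    zeta ^ f, the shift by 1 gives u + v + w = 0 for u = b / a, v = c / b,
    w = a / c.  These have modulus 1 and product 1, so conjugating gives
    uv + vw + wu = 0, and hence u, v, w are cube roots of unity.  They are also
    2m'-th roots of unity with 3 coprime to 2m', so all equal 1 and 3 = 0. *)

(** In an abelian group conjugacy classes are singletons and every centralizer is the whole group,
    so second orthogonality takes this form. *)
Lemma sum_irr_zmod (G : finZmodType) (x y : G) :
  \sum_(i : Iirr [set: G]) 'chi_i x * ('chi_i y)^* = #|G|%:R *+ (x == y).
Proof.
rewrite second_orthogonality_relation ?inE //.
have -> : (x \in (y ^: [set: G])%g) = (x == y).
  apply/imsetP/eqP => [[z _ ->]|->].
    by rewrite conjgE zmodMgE zmodVgE zmodMgE addrC addrK.
  by exists 1%g; rewrite ?inE ?conjg1.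
have -> : 'C_([set: G])[x]%g = [set: G].
  by apply/setIidPl/subsetP => z _; apply/cent1P; exact: zmod_mulgC.
by rewrite cardsT.
Qed.

(** Fourier inversion of the power spectrum: the sum of [F] over all characters is evaluated twice,
    once by bentness and once by expanding the squared modulus. *)
Lemma generalized_bent_autocorrelation (G : finZmodType) (m : nat)
    (zeta : algC) (f : G -> 'Z_m) (t : G) :
    generalized_bent zeta f -> t != 0 ->
  \sum_(x : G) zeta ^+ f (x + t) * (zeta ^+ f x)^* = 0.
Proof.
move=> fbent t0; pose a x := zeta ^+ f x.
have linX (i : Iirr [set: G]) : 'chi_i \is a linear_char.
  by apply: char_abelianP; exact: zmod_abelian.
have cardG0 : #|G|%:R != 0 :> algC.
  by rewrite pnatr_eq0 -lt0n; apply/card_gt0P; exists 0.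
pose F (i : Iirr [set: G]) := `|\sum_x a x * 'chi_i x| ^+ 2 * ('chi_i t)^*.
have sumF0 : \sum_i F i = 0.
  (* The factor ['chi_i 0], equal to 1, is inserted so that orthogonality applies to the pair 0,
     [t]. *)
  rewrite (eq_bigr (fun i => #|G|%:R * ('chi[[set: G]]_i (0 : G) * ('chi_i t)^*))).
    by rewrite -mulr_sumr sum_irr_zmod eq_sym (negPf t0) mulr0n mulr0.
  by move=> i _; rewrite /F fbent // (lin_char1 (linX i)) mul1r.
apply: (mulfI cardG0); rewrite mulr0 -[RHS]sumF0 mulr_sumr.
transitivity (\sum_x \sum_y \sum_i
    a y * (a x)^* * ('chi[[set: G]]_i y * ('chi_i (x + t))^*)); last first.
  rewrite (eq_bigr _ (fun x _ => exchange_big _ _ _ _ _ _)).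
  rewrite exchange_big /=.
  apply: eq_bigr => i _; rewrite /F normCK rmorph_sum mulr_sumr mulr_suml.
  apply: eq_bigr => x _; rewrite !mulr_suml; apply: eq_bigr => y _.
  rewrite -zmodMgE (lin_charM (linX i)) ?inE // !rmorphM /=.
  by rewrite mulrACA !mulrA.
(* Orthogonality kills every [y] other than [x + t]. *)
apply: eq_bigr => x _; rewrite (bigD1 (x + t)) //= -mulr_sumr sum_irr_zmod.
rewrite eqxx mulr1n mulrC big1 ?addr0 // => y /negPf neq_y.
by rewrite -mulr_sumr sum_irr_zmod neq_y mulr0.
Qed.

Lemma normC1_mulconj (z : algC) : `|z| = 1 -> z * z^* = 1.
Proof. by rewrite -normCK => ->; rewrite expr1n. Qed.

Lemma cube_eq1_of_sum_eq0 (u v w : algC) :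
    `|u| = 1 -> `|v| = 1 -> `|w| = 1 -> u * v * w = 1 -> u + v + w = 0 ->
  w ^+ 3 = 1.
Proof.
move=> /normC1_mulconj uu /normC1_mulconj vv /normC1_mulconj ww uvw s0.
have s0' : u^* + v^* + w^* = 0 by rewrite -!rmorphD s0 rmorph0.
have e2 : u * v + v * w + w * u = 0.
  transitivity (u * v * (w * w^*) + v * w * (u * u^*) + w * u * (v * v^*)).
    by rewrite uu vv ww !mulr1.
  by transitivity (u * v * w * (u^* + v^* + w^*)); [ring | rewrite s0' mulr0].
(* [w] is a root of the monic cubic with roots [u], [v], [w], whose two middle coefficients
   vanish. *)
have -> : w ^+ 3 = u * v * w
    + w * (w * (u + v + w) - (u * v + v * w + w * u)) by ring.
by rewrite s0 e2 uvw mulr0 subr0 mulr0 addr0.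
Qed.

(** The order of [z] divides both [m] and [n], hence is 1. *)
Lemma coprime_unity_root (R : idomainType) (m n : nat) (z : R) :
  (0 < m)%N -> coprime m n -> z ^+ m = 1 -> z ^+ n = 1 -> z = 1.
Proof.
move=> m0 co_mn zm zn; have [k zk k_m] := prim_order_exists m0 zm.
have k_n : (k %| n)%N by rewrite (prim_order_dvd zk) zn.
have : (k %| 1)%N by rewrite -(eqP co_mn) dvdn_gcd k_m.
by rewrite dvdn1 => /eqP k1; have := prim_expr_order zk; rewrite k1 expr1.
Qed.

Theorem corollary4p3 (m' : nat) (hodd : odd m') (h3 : ~~ (3 %| m')%N)
    (zeta : algC) (hzeta : (2 * m').-primitive_root zeta) :
  ~ exists f : 'Z_3 -> 'Z_(2 * m'), generalized_bent zeta f.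
Proof.
case=> f /(@generalized_bent_autocorrelation _ _ _ _ 1)/(_ isT).
pose a i := zeta ^+ f i; rewrite -/(a _) => /= corr.
have n0 : (0 < 2 * m')%N := prim_order_gt0 hzeta.
have co3 : coprime 3 (2 * m') by rewrite coprimeMr /= prime_coprime.
have aX i : a i ^+ (2 * m') = 1.
  by rewrite exprAC (prim_expr_order hzeta) expr1n.
have a1 i : `|a i| = 1.
  by apply/eqP; rewrite -(pexpr_eq1 (n := 2 * m')) // -normrX aX normr1.
have aa i := normC1_mulconj (a1 i).
(* The terms of [corr] at x = 0, 1, 2, with 2 + 1 wrapping to 0; conjugates serve as inverses. *)
pose u := a 1 * (a 0)^*; pose v := a 2%:R * (a 1)^*; pose w := a 0 * (a 2%:R)^*.
have norm1 i j : `|a i * (a j)^*| = 1 by rewrite normrM norm_conjC !a1 mulr1.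
have nu : `|u| = 1 := norm1 _ _.
have nv : `|v| = 1 := norm1 _ _.
have nw : `|w| = 1 := norm1 _ _.
have uvw : u * v * w = 1.
  transitivity ((a 0 * (a 0)^*) * (a 1 * (a 1)^*) * (a 2%:R * (a 2%:R)^*)).
    by rewrite /u /v /w; ring.
  by rewrite !aa !mulr1.
have s0 : u + v + w = 0.
  move: corr; rewrite !big_ord_recl big_ord0 addr0 addrA => <-.
  by congr (_ * _^* + _ * _^* + _ * _^*); congr (zeta ^+ f _); apply/val_inj.
have eq1 i j : (a i * (a j)^*) ^+ 3 = 1 -> a i * (a j)^* = 1.
  move=> /(coprime_unity_root _ co3); apply=> //.
  by rewrite exprMn -rmorphXn !aX rmorph1 mulr1.
have w1 : w = 1 by apply: eq1; exact: (@cube_eq1_of_sum_eq0 u v w).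
(* The cube lemma concludes only about its third argument, so the triple is rotated cyclically. *)
have u1 : u = 1.
  apply: eq1; apply: (@cube_eq1_of_sum_eq0 v w u) => //.
    by rewrite -uvw; ring.
  by rewrite -s0; ring.
have v1 : v = 1.
  apply: eq1; apply: (@cube_eq1_of_sum_eq0 w u v) => //.
    by rewrite -uvw; ring.
  by rewrite -s0; ring.
by move/eqP: s0; rewrite u1 v1 w1 -[1]/(1%:R) -!natrD pnatr_eq0.
Qed.
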